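(* (Skew-symmetry) Let $(V,Y,e^{\mathbf z\cdot\mathbf T},|0\rangle)$ be an $(n,N)$-cohomological vertex algebra over a commutative ring $R$. For all homogeneous $a,b\in V$, $$Y(a,\mathbf z)b=p(a,b)\,e^{\mathbf z\cdot\mathbf T}\,Y(b,-\mathbf z)a .$$
   Context: Fix a commutative ring $R$ and integers $N,n$ with $n\ge1$; $\mathbb N=\{0,1,2,\dots\}$. Bold letters are $n$-tuples: variables $\mathbf z=(z_1,\dots,z_n)$, multi-indices in $\mathbb N^n$; $\mathbf 0,\mathbf 1$ are constant tuples; $\mathbf k\ge\mathbf j$ is componentwise; $|\mathbf k|=\sum k_i$; $\mathbf z^{\mathbf k}=\prod z_i^{k_i}$; $\binom{\mathbf k}{\mathbf j}=\prod\binom{k_i}{j_i}$. For a $\mathbb Z$-graded $R$-module, $p(a)$ is the degree of a homogeneous element and $p(a,b)=(-1)^{p(a)p(b)}$. Formal calculus. $\mathcal K^{\mathbf z}_{\mathrm{dist}}(V)$ is the graded $R$-module of series $A(\mathbf z)=\sum_{\mathbf k\ge\mathbf 0}(\mathbf z^{\mathbf k}A_{-\mathbf 1-\mathbf k}+\Omega^{\mathbf k}_{\mathbf z}A_{\mathbf k})$ with coefficients in $V$, where the $z_i$ have degree $0$ and the symbols $\Omega_{\mathbf z}^{\mathbf k}$ have degree $N$; $V\langle\!\langle\mathbf z\rangle\!\rangle$ is the submodule of series for which there is $\mathbf K$ with $A_{\mathbf k}=0$ unless $\mathbf k\le\mathbf K$. $\mathcal K^{\mathbf z,\mathbf w}_{\mathrm{dist}}(V)$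 consists of all formal series in $\mathbf z^{\mathbf j}\mathbf w^{\mathbf k}$, $\mathbf z^{\mathbf j}\Omega^{\mathbf k}_{\mathbf w}$, $\mathbf w^{\mathbf j}\Omega^{\mathbf k}_{\mathbf z}$, $\Omega^{\mathbf j}_{\mathbf z}\Omega^{\mathbf k}_{\mathbf w}$. Products (when no infinite sums of coefficients occur) are given by $\mathbf z^{\mathbf j}\Omega^{\mathbf k}_{\mathbf z}=\Omega^{\mathbf k-\mathbf j}_{\mathbf z}$ if $\mathbf k\ge\mathbf j$ and $0$ otherwise, $\Omega^{\mathbf j}_{\mathbf z}\Omega^{\mathbf k}_{\mathbf z}=0$, $\Omega^{\mathbf j}_{\mathbf z}\Omega^{\mathbf k}_{\mathbf w}=(-1)^N\Omega^{\mathbf k}_{\mathbf w}\Omega^{\mathbf j}_{\mathbf z}$, variables commute with everything, and a homogeneous coefficient $a$ satisfies $a\Omega=(-1)^{p(a)N}\Omega a$. Hasse derivatives: $\partial^{(\mathbf j)}_{\mathbf z}\mathbf z^{\mathbf k}=\binom{\mathbf k}{\mathbf j}\mathbf z^{\mathbf k-\mathbf j}$, $\partial^{(\mathbf j)}_{\mathbf z}\Omega^{\mathbf k}_{\mathbf z}=(-1)^{|\mathbf j|}\binom{\mathbf k+\mathbf j}{\mathbf j}\Omega^{\mathbf k+\mathbf j}_{\mathbf z}$; in a product $\partial^{(\mathbf k)}FG$ the derivative acts on $F$ only. Residue: $\operatorname{Res}_{\mathbf z}(\mathbf z^{\mathbf j}f(\mathbf w))=0$, $\operatorname{Res}_{\mathbf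 z}(\Omega^{\mathbf j}_{\mathbf z}f(\mathbf w))=\delta_{\mathbf j,\mathbf 0}f(\mathbf w)$. $\Delta(\mathbf z,\mathbf w)=\sum_{\mathbf j\ge\mathbf 0}\big(\mathbf w^{\mathbf j}\Omega^{\mathbf j}_{\mathbf z}+(-1)^N\mathbf z^{\mathbf j}\Omega^{\mathbf j}_{\mathbf w}\big)$. Convention: $\Omega^{\mathbf m}_{-\mathbf z}=(-1)^{|\mathbf m|+N+1}\Omega^{\mathbf m}_{\mathbf z}$; thus $Y(b,-\mathbf z)a=\sum_{\mathbf k}\big((-1)^{|\mathbf k|}\mathbf z^{\mathbf k}b_{(-\mathbf 1-\mathbf k)}a+\Omega^{\mathbf k}_{-\mathbf z}b_{(\mathbf k)}a\big)$. Fields. A cohomological field on $V$ is $A(\mathbf z)=\sum_{\mathbf j}(\mathbf z^{\mathbf j}A_{(-\mathbf 1-\mathbf j)}+\Omega^{\mathbf j}_{\mathbf z}A_{(\mathbf j)})\in\mathcal K^{\mathbf z}_{\mathrm{dist}}(\operatorname{End}V)$ with $A(\mathbf z)v\in V\langle\!\langle\mathbf z\rangle\!\rangle$ for all $v$; it is homogeneous of degree $p(A)$ if each $A_{(-\mathbf 1-\mathbf j)}$ has degree $p(A)$ and each $A_{(\mathbf j)}$ has degree $p(A)-N$. $[A(\mathbf z),B(\mathbf w)]=A(\mathbf z)B(\mathbf w)-p(A,B)B(\mathbf w)A(\mathbf z)$. A series $f(\mathbf z,\mathbf w)$ is local if $f=\sum_{\mathbf 0\le\mathbf j\le\mathbf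 K}\partial^{(\mathbf j)}_{\mathbf w}\Delta(\mathbf z,\mathbf w)g^{\mathbf j}(\mathbf w)$ for some $\mathbf K\in\mathbb N^n$, with $g^{\mathbf j}(\mathbf w)=\operatorname{Res}_{\mathbf z}((\mathbf z-\mathbf w)^{\mathbf j}f)$. Fields $A,B$ are mutually local if $[A(\mathbf z),B(\mathbf w)]\in\mathcal K^{\mathbf z,\mathbf w}_{\mathrm{dist}}(\operatorname{End}V)$ is local. An $(n,N)$-cohomological vertex algebra (CVA) $(V,Y,e^{\mathbf z\cdot\mathbf T},|0\rangle)$ over $R$ consists of a $\mathbb Z$-graded $R$-module $V$; a degree $0$ $R$-linear map $Y$, $a\mapsto Y(a,\mathbf z)=\sum_{\mathbf j}(\mathbf z^{\mathbf j}a_{(-\mathbf 1-\mathbf j)}+\Omega^{\mathbf j}_{\mathbf z}a_{(\mathbf j)})\in\mathcal K^{\mathbf z}_{\mathrm{dist}}(\operatorname{End}V)$ (for homogeneous $a$, $a_{(-\mathbf 1-\mathbf j)}$ has degree $p(a)$ and $a_{(\mathbf j)}$ degree $p(a)-N$); degree $0$ endomorphisms $T^{(\mathbf j)}$, $\mathbf j\ge\mathbf 0$, with $T^{(\mathbf 0)}=\mathrm{id}_V$, assembled as $e^{\mathbf z\cdot\mathbf T}=\sum_{\mathbf j}\mathbf z^{\mathbf j}T^{(\mathbf j)}$; and a vacuum $|0\rangle\in V^0$; such that for all $a,b\in V$: (V1) $Y(a,\mathbf z)b\in V\langle\!\langle\mathbf z\rangle\!\rangle$; (V2) $Y(|0\rangle,\mathbf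 z)=\mathrm{id}_V$; (V3) $Y(a,\mathbf z)|0\rangle=e^{\mathbf z\cdot\mathbf T}a$; (V4) $e^{\mathbf w\cdot\mathbf T}Y(a,\mathbf z)e^{-\mathbf w\cdot\mathbf T}=Y(a,\mathbf z+\mathbf w):=\sum_{\mathbf k}\mathbf w^{\mathbf k}\partial^{(\mathbf k)}_{\mathbf z}Y(a,\mathbf z)$; (V5) for homogeneous $a,b$, $Y(a,\mathbf z)$ and $Y(b,\mathbf w)$ are mutually local. *)

(* Defs.v *)
From HB Require Import structures.
From mathcomp Require Import all_boot all_order all_algebra.
From mathcomp Require Import mathcomp_extra boolp classical_sets functions.
From mathcomp Require Import cardinality fsbigop.
From mathcomp Require Import mpoly.

Set Implicit Arguments.
Unset Strict Implicit.
Unset Printing Implicit Defensive.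

Import GRing.Theory.
Local Open Scope classical_set_scope.
Local Open Scope ring_scope.

(* Multi-indices are 'X_{1..n}; their componentwise order is (j <= k)%MM, and
   |k| is mdeg k. *)
Definition mbin n (k j : 'X_{1..n}) : nat := (\prod_(i < n) 'C(k i, j i))%N.

(* (-1)^m for an integer m; only the parity of m matters, so no inverse is
   needed in R. *)
Definition sgn (R : comPzRingType) (m : int) : R := (-1) ^+ `|m|%N.

(* p(a,b) for elements of degrees p and q. *)
Definition koszul (R : comPzRingType) (p q : int) : R := sgn R (p * q).

Section Grading.
Variables (R : comPzRingType) (V : lmodType R).
Implicit Type G : int -> set V.

(* V is the internal direct sum of the submodules G p, p : int. *)
Record is_grading G : Prop := IsGrading {
  grading0 : forall p, G p 0;
  gradingP : forall p (c : R) u v, G p u -> G p v -> G p (c *: u + v);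
  grading_span : forall v, exists (s : seq int) (f : int -> V),
    (forall p, G p (f p)) /\ v = \sum_(p <- s) f p;
  grading_direct : forall (s : seq int) (f : int -> V), uniq s ->
    (forall p, G p (f p)) -> \sum_(p <- s) f p = 0 ->
    forall p, p \in s -> f p = 0 }.

Definition endo_degree G (d : int) (f : V -> V) : Prop :=
  forall p v, G p v -> G (p + d) (f v).

End Grading.

(* The basis symbols z^k and Omega_z^k. *)
Inductive sym n := Mon of 'X_{1..n} | Omg of 'X_{1..n}.
Arguments Mon {n} _.
Arguments Omg {n} _.

Definition sym_code n (s : sym n) : 'X_{1..n} + 'X_{1..n} :=
  match s with Mon k => inl k | Omg k => inr k end.
Definition sym_decode n (c : 'X_{1..n} + 'X_{1..n}) : sym n :=
  match c with inl k => Mon k | inr k => Omg k end.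
Lemma sym_codeK n : cancel (@sym_code n) (@sym_decode n).
Proof. by case. Qed.
HB.instance Definition _ n := Choice.copy (sym n) (can_type (@sym_codeK n)).

Definition sym_deg (N : int) n (s : sym n) : int :=
  if s is Omg _ then N else 0.

(* Product of two symbols in the same variables; None stands for 0. *)
Definition sym_mul n (s t : sym n) : option (sym n) :=
  match s, t with
  | Mon j, Mon k => Some (Mon (j + k)%MM)
  | Mon j, Omg k => if (j <= k)%MM then Some (Omg (k - j)%MM) else None
  | Omg k, Mon j => if (j <= k)%MM then Some (Omg (k - j)%MM) else None
  | Omg _, Omg _ => None
  end.

(* A : series n M is the series \sum_s s (A s), with symbols written to the left
   of the coefficients: A (Mon k) is A_{-1-k} and A (Omg k) is A_k. *)
Definition series n (M : Type) := sym n -> M.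

(* F : series2 n M is the series \sum_(s, t) s_z t_w (F s t), with the symbol in
   z written to the left of the symbol in w. *)
Definition series2 n (M : Type) := sym n -> sym n -> M.

(* Product of two series in the same variables, where op multiplies the
   coefficients and the coefficients of F have degree 0, so that they pass the
   symbols of G without sign.  The sum over the pairs of symbols with product v
   takes the default value 0 if its support is infinite; all the products used
   below have finite support (see kmul_finite). *)
Definition kmul n (A B : Type) (C : nmodType) (op : A -> B -> C)
    (F : series n A) (G : series n B) : series n C :=
  fun v => \sum_(st \in [set st : sym n * sym n | sym_mul st.1 st.2 = Some v])
             op (F st.1) (G st.2).

Section Calculus.
Variables (R : comPzRingType) (N : int) (n : nat).

(* The submodule M<<z>>. *)
Definition lower_truncated (M : lmodType R) (A : series n M) : Prop :=
  exists K : 'X_{1..n}, forall k, ~~ (k <= K)%MM -> A (Omg k) = 0.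

(* A(-z), with Omega_{-z}^k = (-1)^(|k| + N + 1) Omega_z^k. *)
Definition negz (M : lmodType R) (A : series n M) : series n M :=
  fun s => match s with
           | Mon k => sgn R (mdeg k)%:Z *: A (Mon k)
           | Omg k => sgn R ((mdeg k)%:Z + N + 1) *: A (Omg k)
           end.

(* The Hasse derivative of order j. *)
Definition hasse (M : lmodType R) (j : 'X_{1..n}) (A : series n M)
    : series n M :=
  fun s => match s with
           | Mon k => A (Mon (k + j)%MM) *+ mbin (k + j)%MM j
           | Omg k => if (j <= k)%MM
                      then sgn R (mdeg j)%:Z *: (A (Omg (k - j)%MM) *+ mbin k j)
                      else 0
           end.

Definition hasse_w (M : lmodType R) (j : 'X_{1..n}) (F : series2 n M)
    : series2 n M :=
  fun s => hasse j (F s).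

(* Multiplication by the monomial z^j. *)
Definition mon_mul (M : lmodType R) (j : 'X_{1..n}) (A : series n M)
    : series n M :=
  fun s => match s with
           | Mon k => if (j <= k)%MM then A (Mon (k - j)%MM) else 0
           | Omg k => A (Omg (k + j)%MM)
           end.

Definition mon_mul_z (M : lmodType R) (j : 'X_{1..n}) (F : series2 n M)
    : series2 n M :=
  fun s t => mon_mul j (F^~ t) s.

Definition mon_mul_w (M : lmodType R) (j : 'X_{1..n}) (F : series2 n M)
    : series2 n M :=
  fun s => mon_mul j (F s).

(* Multiplication by
   (z - w)^j = \sum_(i <= j) (-1)^|i| 'C(j, i) z^(j - i) w^i;
   the index type is a finite type containing all multi-indices i <= j. *)
Definition zw_mul (M : lmodType R) (j : 'X_{1..n}) (F : series2 n M)
    : series2 n M :=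
  fun s t => \sum_(i : 'X_{1..n < (mdeg j).+1} | (i <= j)%MM)
    sgn R (mdeg i)%:Z *: (mon_mul_z (j - i)%MM (mon_mul_w i F) s t *+ mbin j i).

Definition res_z (M : lmodType R) (F : series2 n M) : series n M :=
  F (Omg 0%MM).

(* Delta(z, w) = \sum_j (w^j Omega_z^j + (-1)^N z^j Omega_w^j). *)
Definition Delta : series2 n R^o :=
  fun s t => match s, t with
             | Omg j, Mon k => (j == k)%:R
             | Mon j, Omg k => sgn R N *+ (j == k)
             | _, _ => 0
             end.

(* f = \sum_(0 <= j <= K) (d_w^(j) Delta(z, w)) g^j(w)
   with g^j(w) = Res_z ((z - w)^j f(z, w)). *)
Definition is_local (M : lmodType R) (f : series2 n M) : Prop :=
  exists K : 'X_{1..n}, forall s,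
    f s = \sum_(j : 'X_{1..n < (mdeg K).+1} | (j <= K)%MM)
            kmul (fun (c : R) (x : M) => c *: x)
                 (hasse_w j Delta s) (res_z (zw_mul j f)).

Variable V : lmodType R.

(* A(z) B(w) for A homogeneous of degree p: A s has degree p - sym_deg N s, and
   the sign comes from moving it past the symbol t_w. *)
Definition field_mul (p : int) (A B : series n (V -> V))
    : series2 n (V -> V) :=
  fun s t => koszul R (p - sym_deg N s) (sym_deg N t) *: (A s \o B t).

(* Rewrites a series \sum t_w s_z (F t s) in the order s_z t_w, using
   Omega_w Omega_z = (-1)^N Omega_z Omega_w. *)
Definition swap_zw (F : series2 n (V -> V)) : series2 n (V -> V) :=
  fun s t => match s, t with
             | Omg _, Omg _ => sgn R N *: F t s
             | _, _ => F t s
             end.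

(* [A(z), B(w)] for A and B homogeneous of degrees p and q. *)
Definition field_comm (p q : int) (A B : series n (V -> V))
    : series2 n (V -> V) :=
  fun s t => field_mul p A B s t
             - koszul R p q *: swap_zw (field_mul q B A) s t.

Definition mutually_local (p q : int) (A B : series n (V -> V)) : Prop :=
  is_local (field_comm p q A B).

(* e^{z.T} *)
Definition expT (T : 'X_{1..n} -> {linear V -> V}) : series n (V -> V) :=
  fun s => if s is Mon j then T j : V -> V else 0.

(* Y a (Mon j) is a_(-1-j) and Y a (Omg j) is a_(j). *)
Definition vfield (Y : V -> series n {linear V -> V}) (a : V)
    : series n (V -> V) :=
  fun s => Y a s.

(* Y(a, z) b *)
Definition vapp (Y : V -> series n {linear V -> V}) (a b : V) : series n V :=
  fun s => Y a s b.

Record is_CVA (G : int -> set V) (Y : V -> series n {linear V -> V})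
    (T : 'X_{1..n} -> {linear V -> V}) (vac : V) : Prop := IsCVA {
  cva_grading : is_grading G;
  cva_linear : forall s v, linear (fun a => Y a s v);
  cva_degree : forall p a s, G p a -> endo_degree G (p - sym_deg N s) (Y a s);
  cva_T_degree : forall j, endo_degree G 0 (T j);
  cva_T0 : forall v, T 0%MM v = v;
  cva_vac_degree : G 0 vac;
  cva_trunc : forall a b, lower_truncated (vapp Y a b);
  cva_vac : forall s, vfield Y vac s = if s == Mon 0%MM then id else 0;
  cva_create : forall a, vapp Y a vac = fun s => expT T s a;
  (* e^{w.T} Y(a, z) e^{-w.T} = \sum_k w^k d_z^(k) Y(a, z), compared at each
     symbol s in z as series in w. *)
  cva_translation : forall a s,
    kmul (fun f g : V -> V => f \o vfield Y a s \o g) (expT T) (negz (expT T))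
    = fun t => if t is Mon k then hasse k (vfield Y a) s else 0;
  cva_local : forall p q a b, G p a -> G q b ->
    mutually_local p q (vfield Y a) (vfield Y b) }.

End Calculus.

Section Finiteness.
Variable n : nat.

Lemma kmul_finite (A B : Type) (C : nmodType) (op : A -> B -> C)
    (F : series n A) (G : series n B) (v : sym n) (D : set (sym n)) :
  finite_set D ->
  (forall s t, sym_mul s t = Some v -> op (F s) (G t) <> 0 -> D s) ->
  finite_set ([set st : sym n * sym n | sym_mul st.1 st.2 = Some v] `&`
              (fun st => op (F st.1) (G st.2)) @^-1` [set~ 0]).
Proof.
move=> finD HD.
pose quo (s : sym n) : sym n := match s, v with
  | Mon j, Mon k => Mon (k - j)%MM
  | Mon j, Omg k => Omg (k + j)%MM
  | Omg j, Omg k => Mon (j - k)%MM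
  | Omg _, Mon _ => Mon 0%MM end.
apply: (sub_finite_set _ (finite_image (fun s => (s, quo s)) finD)).
move=> [s t] [/= e ne0]; exists s; first exact: HD e ne0.
congr pair; rewrite /quo; move: e {HD ne0 quo}.
case: s t => j [k|k] //=.
- by move=> [<-]; rewrite addmC addmK.
- by case: ifP => // jk [<-]; rewrite submK.
- case: ifP => // kj [<-]; congr Mon.
  by rewrite -{1}(submK kj) addmC addmK.
Qed.

Lemma finite_le_mnm (K : 'X_{1..n}) : finite_set [set j : 'X_{1..n} | (j <= K)%MM].
Proof.
apply: (@sub_finite_set _ _ [set bmnm i | i in [set: 'X_{1..n < (mdeg K).+1}]]).
  move=> j /= jK; have lt : (mdeg j < (mdeg K).+1)%N.
    by rewrite ltnS !mdegE leq_sum // => i _; apply/mnm_lepP.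
  by exists (BMultinom lt).
exact: finite_image finite_finset.
Qed.

End Finiteness.

Section FinitenessCVA.
Variables (R : comPzRingType) (N : int) (n : nat) (V : lmodType R).
Variable T : 'X_{1..n} -> {linear V -> V}.

Lemma expT_finite (X : series n V) (v : sym n) : lower_truncated X ->
  finite_set ([set st : sym n * sym n | sym_mul st.1 st.2 = Some v] `&`
              (fun st => expT T st.1 (X st.2)) @^-1` [set~ 0]).
Proof.
move=> [K XK]; pose m := match v with Mon k => k | Omg _ => K end.
apply: (@kmul_finite n _ _ _ (fun f x => f x) _ _ _
          _ (finite_image Mon (finite_le_mnm m))).
move=> [j|j] t e ne0; last by case: ne0.
exists j => //=; case: t e ne0 => k /=.
  by move=> [e] _; rewrite /m -e lem_addr.
case: ifP => // jk [e] ne0; rewrite /m -e.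
have [kK|nkK] := boolP (k <= K)%MM; first exact: lepm_trans jk kK.
by case: ne0; rewrite XK // linear0.
Qed.

Lemma conjT_finite (f : {linear V -> V}) (v : sym n) :
  finite_set ([set st : sym n * sym n | sym_mul st.1 st.2 = Some v] `&`
              (fun st => (expT T st.1 \o f \o negz N (expT T) st.2 : V -> V))
                @^-1` [set~ 0]).
Proof.
pose m := match v with Mon k => k | Omg _ => 0%MM end.
apply: (@kmul_finite n _ _ _ (fun g h : V -> V => g \o f \o h) _ _ _
          _ (finite_image Mon (finite_le_mnm m))).
move=> [j|j] t e ne0; last by case: ne0.
exists j => //=; case: t e ne0 => k /=.
  by move=> [e] _; rewrite /m -e lem_addr.
move=> _ []; apply/funext => x /=.
by rewrite scaler0 /= !linear0.
Qed.

Lemma Delta_finite (M : lmodType R) (j : 'X_{1..n}) (s : sym n)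
    (g : series n M) (v : sym n) :
  finite_set ([set st : sym n * sym n | sym_mul st.1 st.2 = Some v] `&`
              (fun st => hasse_w j (Delta R N (n := n)) s st.1 *: g st.2)
                @^-1` [set~ 0]).
Proof.
pose t0 := match s with Mon k => Omg (k + j)%MM | Omg k => Mon (k - j)%MM end.
apply: (@kmul_finite n _ _ _ (fun (c : R) (x : M) => c *: x)
          (hasse_w j (Delta R N (n := n)) s) g v _ (finite_set1 t0)).
move=> t u _ /= ne0.
have {}ne0 : hasse_w j (Delta R N (n := n)) s t <> 0.
  by move=> e; case: ne0; rewrite e scale0r.
have z0 m : (0 : R^o) *+ m = 0 by exact: mul0rn.
have z1 (c : R) m : c *: ((0 : R^o) *+ m) = 0 by rewrite z0 scaler0.
rewrite /t0; case: s t ne0 {t0} => k [l|l]; rewrite /hasse_w /=.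
- by case; exact: z0.
- case: ifP => // jl; case: eqP => [-> _|_]; first by rewrite submK.
  by case; exact: z1.
- case: eqP => [-> _|_]; first by rewrite addmK.
  by case; exact: z0.
- by case: ifP => // _; case; exact: z1.
Qed.

End FinitenessCVA.

(* Main.v *)
Require Import Defs.
From HB Require Import structures.
From mathcomp Require Import all_boot all_order all_algebra.
From mathcomp Require Import mathcomp_extra boolp classical_sets functions.
From mathcomp Require Import cardinality fsbigop.
From mathcomp Require Import mpoly zify.

Import GRing.Theory.
Local Open Scope classical_set_scope.
Local Open Scope ring_scope.

(** The commutator of Y(b, z) and Y(a, w) is local.  Apply the locality
expansion to the vacuum: by the creation axiom Y(a, w)|0> = e^{w.T} a, so the
commutator becomes
  f(z, w) = Y(b, z) e^{w.T} a - p(a,b) Y(a, w) e^{z.T} b,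
and locality says f = sum_(j <= K) d_w^(j) Delta(z, w) g^j(w), where
g^j(w) = Res_z ((z - w)^j f).  Skew-symmetry is what remains of this identity in
z-degree 0, that is at the symbol z^0, where the second term is
p(a,b) Y(a, w) b.  (The lemmas on locality are stated with a and b exchanged.)

Everything then rests on moving e^{w.T} across a field.  Translation covariance
of Y(|0>, z) = id says that e^{-w.T} is a right inverse of e^{w.T}, and the
substitution w -> -w makes it a left inverse (expT_rinv, expT_linv).  Hence
  e^{w.T} Y(c, z) = Y(c, z + w) e^{w.T}   (translation_conv).

Regular part.  Every derivative of Delta pairs a power of one variable with an
Omega of the other, so f has no z^j w^k terms, and at z^0
  Y(b, z)|_{z^0} e^{w.T} a = p(a,b) Y(a, w)_{reg} b   (locality_Mon).
On the other hand the regular part of Y(b, w) is e^{w.T} Y(b, z)|_{z^0} e^{-w.T},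
so the left-hand side is e^{w.T} Y(b, -w)_{reg} a (expT_negz_Mon).

Singular part.  In g^j(w) the second term of f is killed by the residue, and
since (z - w)^j Y(b, z) e^{w.T} a = (z - w)^j e^{w.T} Y(b, z - w) a, the residue is
g^j(w) = e^{w.T} b_(j) a (res_comm_vac).  At z^0 the derivative d_w^(j) Delta
contributes (-1)^(N + |j|) Omega_w^j, and comparing coefficients of Omega_w^m gives
  - p(a,b) a_(m) b = (-1)^N sum_(m <= j <= K) (-1)^|j| T^(j - m) b_(j) a
(locality_Omg).  This is the coefficient of Omega^m in the claim; the sign
(-1)^(|j| + N + 1) is that of Omega_{-z}^j. *)

(** * Sums over the multi-indices below a given one *)

Section MultiIndexSums.
Set Implicit Arguments.
Unset Strict Implicit.
Variable n : nat.
Implicit Types i j k l : 'X_{1..n}.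

(** A list rather than a predicate on a bounded finite type: the bound of that type
depends on k, and sums over different boxes have to be compared. *)
Definition below k : seq 'X_{1..n} :=
  [seq bmnm b | b <- enum [pred b : 'X_{1..n < (mdeg k).+1} | (b <= k)%MM]].

Lemma mem_below i k : (i \in below k) = (i <= k)%MM.
Proof.
apply/mapP/idP => [[j]|ik]; first by rewrite mem_enum => jk ->.
have lt : (mdeg i < (mdeg k).+1)%N.
  by rewrite ltnS !mdegE leq_sum // => x _; apply/mnm_lepP.
by exists (BMultinom lt); rewrite ?mem_enum.
Qed.

Lemma below_uniq k : uniq (below k).
Proof. by rewrite map_inj_uniq ?enum_uniq //; exact: val_inj. Qed.

Lemma big_below (M : nmodType) (F : 'X_{1..n} -> M) k :
  \sum_(i : 'X_{1..n < (mdeg k).+1} | (i <= k)%MM) F i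
  = \sum_(i <- below k) F i.
Proof. by rewrite big_map big_enum. Qed.

Lemma sum_below_single (M : nmodType) (F : 'X_{1..n} -> M) m k : (m <= k)%MM ->
  (forall i, (i <= k)%MM -> i != m -> F i = 0) -> \sum_(i <- below k) F i = F m.
Proof.
move=> mk F0; rewrite (bigD1_seq m) ?mem_below ?below_uniq //=.
rewrite big_seq_cond big1 ?addr0 // => i; rewrite mem_below => /andP[ik im].
exact: F0.
Qed.

Lemma le0mnm k : (0 <= k)%MM.
Proof. by apply/mnm_lepP => i; rewrite mnmE. Qed.

Lemma subm_self k : (k - k = 0)%MM.
Proof. by apply/mnmP => i; rewrite !mnmE subnn. Qed.

Lemma subm_subm i k : (i <= k)%MM -> (k - (k - i))%MM = i.
Proof. by move=> ik; rewrite submBA // addmC addmK. Qed.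

Lemma mbinn k : mbin k k = 1%N.
Proof. by rewrite /mbin big1 // => i _; rewrite binn. Qed.

Lemma below_up i k : (i <= k)%MM ->
  perm_eq [seq l <- below k | (i <= l)%MM] [seq (i + r)%MM | r <- below (k - i)%MM].
Proof.
move=> ik; apply: uniq_perm.
- exact: filter_uniq (below_uniq k).
- rewrite map_inj_uniq ?below_uniq // => x y.
  by rewrite ![(i + _)%MM]addmC => /(can_inj (@addmK _ i)).
move=> l; rewrite mem_filter mem_below.
apply/andP/mapP => [[il lk]|[r]].
  exists (l - i)%MM; last by rewrite addmC submK.
  rewrite mem_below; apply/mnm_lepP => x; rewrite !mnmE.
  by rewrite leq_sub2r //; apply/mnm_lepP.
rewrite mem_below => rki ->; split; first exact: lem_addr.
rewrite -(submK ik) addmC; apply/mnm_lepP => x; rewrite !mnmE leq_add2r.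
by have := mnm_lepP rki x; rewrite !mnmE.
Qed.

Lemma sum_below_swap (M : nmodType) (F : 'X_{1..n} -> M) i k :
  \sum_(l <- below i | (l <= k)%MM) F l = \sum_(l <- below k | (l <= i)%MM) F l.
Proof.
rewrite -big_filter -[RHS]big_filter; apply: perm_big.
apply: uniq_perm; try exact: filter_uniq (below_uniq _).
by move=> l; rewrite !mem_filter !mem_below andbC.
Qed.

(** Associativity of the Cauchy product, before the three factors are multiplied;
the factors below are operators that do not commute. *)
Lemma sum_below_assoc (M : nmodType)
    (F : 'X_{1..n} -> 'X_{1..n} -> 'X_{1..n} -> M) k :
  \sum_(l <- below k) \sum_(i <- below l) F i (l - i)%MM (k - l)%MM
  = \sum_(i <- below k) \sum_(r <- below (k - i)%MM) F i r (k - i - r)%MM.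
Proof.
transitivity (\sum_(l <- below k) \sum_(i <- below k | (i <= l)%MM)
                 F i (l - i)%MM (k - l)%MM).
  rewrite [LHS]big_seq [RHS]big_seq; apply: eq_bigr => l.
  rewrite mem_below => lk; rewrite -[RHS]big_filter; apply: perm_big.
  apply: uniq_perm; [exact: below_uniq | exact: filter_uniq (below_uniq k) |].
  move=> i; rewrite mem_filter !mem_below andb_idr // => il.
  exact: lepm_trans il lk.
rewrite (exchange_big_dep xpredT) //= big_seq [RHS]big_seq; apply: eq_bigr => i.
rewrite mem_below => ik; rewrite -big_filter (perm_big _ (below_up ik)) big_map.
by apply: eq_bigr => r _; rewrite submDA {1}addmC addmK.
Qed.

End MultiIndexSums.

(** * Signs *)

Section Signs.
Set Implicit Arguments.
Variable R : comPzRingType.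

Lemma sgnD (x y : int) : sgn R (x + y) = sgn R x * sgn R y.
Proof.
rewrite /sgn -exprD -signr_odd -[RHS]signr_odd oddD; congr (_ ^+ _).
by case: x y => [x|x] [y|y]; lia.
Qed.

Lemma sgn0 : sgn R 0 = 1. Proof. by rewrite /sgn expr0. Qed.

Lemma sgn_sqr (x : int) : sgn R x * sgn R x = 1.
Proof. by rewrite /sgn -exprD addnn -signr_odd odd_double. Qed.

Lemma sgn_mdegB n (i k : 'X_{1..n}) : (i <= k)%MM ->
  sgn R (mdeg (k - i)%MM) * sgn R (mdeg k) = sgn R (mdeg i).
Proof.
by move=> ik; rewrite -{2}(submK ik) mdegD PoszD sgnD mulrA sgn_sqr mul1r.
Qed.

End Signs.

(** * Coefficients of products of series *)

Section SeriesProducts.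
Set Implicit Arguments.
Unset Strict Implicit.
Variables (n : nat) (A B : Type) (C : nmodType) (op : A -> B -> C).
Variables (F : series n A) (G : series n B).

Lemma kmul_seq (r : seq (sym n * sym n)) v : uniq r ->
  (forall st, st \in r -> sym_mul st.1 st.2 = Some v) ->
  (forall st, sym_mul st.1 st.2 = Some v -> st \notin r ->
     op (F st.1) (G st.2) = 0) ->
  kmul op F G v = \sum_(st <- r) op (F st.1) (G st.2).
Proof.
move=> ur rv r0; rewrite /kmul (fsbigE r) //.
rewrite big_seq_cond [RHS]big_seq; apply: eq_bigl => st.
by rewrite andb_idr // => /rv e; rewrite inE.
Qed.

Lemma kmul_Mon k :
  kmul op F G (Mon k) = \sum_(i <- below k) op (F (Mon i)) (G (Mon (k - i)%MM)).
Proof.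
rewrite (@kmul_seq [seq (Mon i, Mon (k - i)%MM) | i <- below k]) ?big_map //.
- by rewrite map_inj_uniq ?below_uniq // => i j [].
- move=> st /mapP[i]; rewrite mem_below => ik -> /=.
  by rewrite addmC submK.
move=> [[i|i] [j|j]] //=; try by case: ifP.
move=> [<-] /mapP []; exists i; first by rewrite mem_below lem_addr.
by rewrite {1}addmC addmK.
Qed.

Lemma sym_mulI (s t t' : sym n) v :
  sym_mul s t = Some v -> sym_mul s t' = Some v -> t = t'.
Proof.
have MonI : injective (@Mon n) by move=> x y [].
have SomeI : injective (@Some (sym n)) by move=> x y [].
have OmgI : injective (@Omg n) by move=> x y [].
move=> e e'; move: {e'} e (etrans e (esym e')).
case: s t t' => i [j|j] [j'|j'] //=; do ?[case: ifP => // ?];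
  move=> _ //.
- move=> /SomeI/MonI; rewrite ![(i + _)%MM]addmC.
  by move=> /(can_inj (@addmK _ i)) ->.
- by move=> /SomeI/OmgI e; congr Omg; rewrite -(@submK _ i j) // e submK.
- move=> /SomeI/OmgI e; congr Mon.
  by rewrite -(@subm_subm _ j i) // e subm_subm.
Qed.

(** For the derivatives of Delta: at a fixed symbol in z, each of them is a multiple of
a single symbol in w. *)
Lemma kmul_concentrated s t v : (forall s' x, s' <> s -> op (F s') x = 0) ->
  sym_mul s t = Some v -> kmul op F G v = op (F s) (G t).
Proof.
move=> F0 e; rewrite (@kmul_seq [:: (s, t)]) ?big_seq1 //.
  by move=> st; rewrite inE => /eqP ->.
move=> [s' t'] /= e'; rewrite inE => ne; apply: F0 => es.
by move: e' ne; rewrite es => /(sym_mulI e) <-; rewrite eqxx.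
Qed.

Lemma kmul_concentrated0 s v : (forall s' x, s' <> s -> op (F s') x = 0) ->
  (forall t, sym_mul s t <> Some v) -> kmul op F G v = 0.
Proof.
move=> F0 e; rewrite (@kmul_seq [::]) ?big_nil // => -[s' t'] /= e' _.
by apply: F0 => es; apply: (e t'); rewrite -es.
Qed.

(** The shape of e^{z.T} acting on a truncated series: only powers of z on the left,
and the sum is cut off by the bound K on the singular part on the right. *)
Lemma kmul_Omg K k : (forall j x, op (F (Omg j)) x = 0) ->
  (forall i, ~~ (k + i <= K)%MM -> op (F (Mon i)) (G (Omg (k + i)%MM)) = 0) ->
  kmul op F G (Omg k)
  = \sum_(i <- below K | (k <= i)%MM) op (F (Mon (i - k)%MM)) (G (Omg i)).
Proof.
move=> F0 G0.
rewrite (@kmul_seq [seq (Mon (i - k)%MM, Omg i) | i <- below K & (k <= i)%MM]).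
- by rewrite big_map big_filter.
- rewrite map_inj_uniq; last by move=> i j [].
  exact: filter_uniq (below_uniq K).
- move=> st /mapP[i]; rewrite mem_filter => /andP[ki _] -> /=.
  by rewrite lem_subr subm_subm.
move=> [[i|i] [j|j]] //=.
case: ifP => // ij [ek] nin; have ej : (k + i)%MM = j by rewrite -ek submK.
rewrite -[j in Omg j]ej G0 // ej; apply: contra nin => jK.
apply/mapP; exists j; first by rewrite mem_filter mem_below jK -ej lem_addr.
by rewrite -[in (_ - _)%MM]ek subm_subm.
Qed.

End SeriesProducts.

(** * Translation in a vertex algebra *)

Section VertexAlgebra.
Set Implicit Arguments.
Unset Strict Implicit.
Variables (R : comPzRingType) (N : int) (n : nat) (V : lmodType R).
Variables (G : int -> set V) (Y : V -> series n {linear V -> V}).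
Variables (T : 'X_{1..n} -> {linear V -> V}) (vac : V).
Hypothesis hV : is_CVA N G Y T vac.
Implicit Types (a b x : V) (i j k l m : 'X_{1..n}).

Lemma translation_coef a s k x :
  \sum_(i <- below k) T i (Y a s (sgn R (mdeg (k - i)%MM)%:Z *: T (k - i)%MM x))
  = hasse k (vfield Y a) s x.
Proof.
have /(congr1 (fun F => F (Mon k) x)) := cva_translation hV a s.
by rewrite kmul_Mon /= fct_sumE.
Qed.

(** e^{w.T} e^{-w.T} = 1, which is translation covariance for the constant field
Y(|0>, z) = id: all its derivatives of positive order vanish. *)
Lemma expT_rinv k x :
  \sum_(i <- below k) T i (sgn R (mdeg (k - i)%MM)%:Z *: T (k - i)%MM x)
  = x *+ (k == 0%MM).
Proof.
have vacE s y : Y vac s y = y *+ (s == Mon 0%MM).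
  have /(congr1 (fun F => F y)) := cva_vac hV s; rewrite /vfield => ->.
  by case: eqP => _; rewrite ?mulr1n ?mulr0n.
transitivity (hasse k (vfield Y vac) (Mon 0%MM) x).
  rewrite -translation_coef; apply: eq_bigr => i _.
  by rewrite vacE eqxx mulr1n.
by rewrite /= add0m mbinn mulr1n /vfield vacE.
Qed.

(** e^{-w.T} e^{w.T} = 1: the coefficient of w^k differs from the one in expT_rinv by
the overall sign (-1)^|k|. *)
Lemma expT_linv k x :
  \sum_(i <- below k) sgn R (mdeg i)%:Z *: T i (T (k - i)%MM x)
  = x *+ (k == 0%MM).
Proof.
transitivity (sgn R (mdeg k)%:Z *: (x *+ (k == 0%MM))); last first.
  case: eqP => [->|_]; last by rewrite scaler0.
  by rewrite mdeg0 /sgn expr0 scale1r.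
rewrite -expT_rinv scaler_sumr big_seq [RHS]big_seq.
apply: eq_bigr => i; rewrite mem_below => ik.
rewrite linearZ scalerA; congr (_ *: _).
by rewrite mulrC sgn_mdegB.
Qed.

(** e^{w.T} Y(a, z) = Y(a, z + w) e^{w.T}: cancel e^{-w.T} in the translation axiom by
multiplying with e^{w.T} on the right. *)
Lemma translation_conv a s k x :
  T k (Y a s x)
  = \sum_(l <- below k) hasse l (vfield Y a) s (T (k - l)%MM x).
Proof.
pose F i r t := T i (Y a s (sgn R (mdeg r)%:Z *: T r (T t x))).
transitivity (\sum_(l <- below k) \sum_(i <- below l) F i (l - i)%MM (k - l)%MM);
  last by apply: eq_bigr => l _; rewrite translation_coef.
rewrite sum_below_assoc.
transitivity (\sum_(i <- below k) T i (Y a s (x *+ ((k - i)%MM == 0%MM)))); last first.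
  apply: eq_bigr => i _; rewrite -expT_linv !linear_sum /=.
  by apply: eq_bigr => r _.
rewrite (sum_below_single (lepm_refl k)) ?subm_self ?eqxx ?mulr1n // => i ik ik'.
case: eqP => [ki0|_]; last by rewrite mulr0n !linear0.
by rewrite -(submK ik) ki0 add0m eqxx in ik'.
Qed.

(** Translation covariance at z^0, with w replaced by -w, expresses the regular part
of Y(a, -w) as the z^0 part of e^{-w.T} Y(a, z) e^{w.T}; multiply by e^{w.T} on the
left.  Expanding Y(a, z + w) at z = -w would instead lead to alternating sums of
binomials. *)
Lemma expT_negz_Mon a k x :
  \sum_(i <- below k) T i (sgn R (mdeg (k - i)%MM)%:Z *: Y a (Mon (k - i)%MM) x)
  = Y a (Mon 0%MM) (T k x).
Proof.
have YMon l : sgn R (mdeg l)%:Z *: Y a (Mon l) x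
    = \sum_(r <- below l) sgn R (mdeg r)%:Z *: T r (Y a (Mon 0%MM) (T (l - r)%MM x)).
  have := translation_coef a (Mon 0%MM) l x.
  rewrite /= add0m mbinn mulr1n /vfield => <-; rewrite scaler_sumr.
  rewrite big_seq [RHS]big_seq; apply: eq_bigr => r; rewrite mem_below => rl.
  rewrite !linearZ /= scalerA; congr (_ *: _).
  exact: sgn_mdegB.
pose F i r t := T i (sgn R (mdeg r)%:Z *: T r (Y a (Mon 0%MM) (T t x))).
transitivity (\sum_(i <- below k) \sum_(r <- below (k - i)%MM)
                F i r (k - i - r)%MM).
  by apply: eq_bigr => i _; rewrite YMon linear_sum.
rewrite -sum_below_assoc (sum_below_single (le0mnm k)).
  by rewrite expT_rinv subm0 eqxx mulr1n.
by move=> l _ /negPf l0; rewrite /F expT_rinv l0 mulr0n.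
Qed.

(** * Locality applied to the vacuum *)

Section Locality.
Variables (p q : int) (a b : V).
Hypotheses (ha : G p a) (hb : G q b).

Let f := field_comm N p q (vfield Y a) (vfield Y b).

Let Y_vac_Mon c k : Y c (Mon k) vac = T k c.
Proof. by have /(congr1 (fun F => F (Mon k))) := cva_create hV c. Qed.

Let Y_vac_Omg c k : Y c (Omg k) vac = 0.
Proof. by have /(congr1 (fun F => F (Omg k))) := cva_create hV c. Qed.

Lemma comm_vac_Omg_Mon j k : f (Omg j) (Mon k) vac = Y a (Omg j) (T k b).
Proof.
transitivity (koszul R (p - N) 0 *: Y a (Omg j) (Y b (Mon k) vac)
  - koszul R p q *: (koszul R (q - 0) N *: Y b (Mon k) (Y a (Omg j) vac))).
  by [].
by rewrite Y_vac_Mon Y_vac_Omg /koszul mulr0 sgn0 scale1r linear0 !scaler0 subr0.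
Qed.

Lemma comm_vac_Mon_Mon j k : f (Mon j) (Mon k) vac
  = Y a (Mon j) (T k b) - koszul R p q *: Y b (Mon k) (T j a).
Proof.
transitivity (koszul R (p - 0) 0 *: Y a (Mon j) (Y b (Mon k) vac)
  - koszul R p q *: (koszul R (q - 0) 0 *: Y b (Mon k) (Y a (Mon j) vac))).
  by [].
by rewrite !Y_vac_Mon /koszul !mulr0 sgn0 !scale1r.
Qed.

Lemma comm_vac_Mon_Omg j k :
  f (Mon j) (Omg k) vac = - (koszul R p q *: Y b (Omg k) (T j a)).
Proof.
transitivity (koszul R (p - 0) N *: Y a (Mon j) (Y b (Omg k) vac)
  - koszul R p q *: (koszul R (q - N) 0 *: Y b (Omg k) (Y a (Mon j) vac))).
  by [].
rewrite Y_vac_Mon Y_vac_Omg /koszul mulr0 sgn0 scale1r linear0 scaler0.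
by rewrite sub0r.
Qed.

(** Both sides are the coefficient of w^k in Res_z ((z - w)^i Y(a, z)) e^{w.T} b: the
binomial expansion of (z - w)^i on the left is the list of Hasse derivatives of
Omega on the right, since Res_z (z - w)^i Y(a, z) = Res_z z^i Y(a, z + w). *)
Lemma res_comm_vac i k :
  res_z (zw_mul i f) (Mon k) vac = T k (Y a (Omg i) b).
Proof.
pose H l := sgn R (mdeg l) *: (Y a (Omg (i - l)%MM) (T (k - l)%MM b) *+ mbin i l).
rewrite translation_conv; transitivity (\sum_(l <- below k | (l <= i)%MM) H l);
  last first.
  rewrite big_mkcond; apply: eq_bigr => l _ /=.
  by case: ifP => // _; rewrite scalrfctE natmulfctE.
rewrite sum_below_swap big_mkcond /res_z /zw_mul.
rewrite (big_below (fun l => sgn R (mdeg l) *: (mon_mul_z (i - l)%MM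
  (mon_mul_w l f) (Omg 0%MM) (Mon k) *+ mbin i l))) fct_sumE.
apply: eq_bigr => l _; rewrite scalrfctE natmulfctE /mon_mul_z /mon_mul_w /=.
rewrite add0m; case: ifP => _; last by rewrite mul0rn scaler0.
by rewrite comm_vac_Omg_Mon.
Qed.

Lemma locality_vac : exists K : 'X_{1..n}, forall s t,
  f s t vac = \sum_(j <- below K)
    kmul (fun (c : R) (x : V -> V) => c *: x)
         (hasse_w j (Delta R N (n := n)) s) (res_z (zw_mul j f)) t vac.
Proof.
have [K loc] := cva_local hV ha hb; exists K => s t.
rewrite /f loc (big_below (fun j => kmul (fun (c : R) (x : V -> V) => c *: x)
  (hasse_w j (Delta R N (n := n)) s) (res_z (zw_mul j f)))).
by rewrite !fct_sumE.
Qed.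

(** No derivative of Delta(z, w) contains a product z^j w^k. *)
Lemma locality_Mon k :
  Y a (Mon 0%MM) (T k b) = koszul R p q *: Y b (Mon k) a.
Proof.
have [K loc] := locality_vac.
have := comm_vac_Mon_Mon 0%MM k; rewrite (cva_T0 hV) loc big1 => [e|j _].
  by apply/subr0_eq; rewrite -e.
by rewrite kmul_Mon big1 // => i _; rewrite /= mul0rn scale0r.
Qed.

Lemma hasse_Delta_Mon0 j s : s <> Omg j ->
  hasse_w j (Delta R N (n := n)) (Mon 0%MM) s = 0.
Proof.
case: s => [i|i] ne; rewrite /hasse_w /=; first exact: mul0rn.
case: ifP => // ji; case: eqP => [e|_]; last by rewrite !mulr0n mul0rn scaler0.
by case: ne; rewrite -(submK ji) -e add0m.
Qed.

(** The order K of locality also bounds the singular part of Y(a, z)b, because the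
coefficient of Omega_z^i w^0 in the local expansion comes from j = i only.  This
makes the sum over i <= K below the whole singular part of e^{z.T} Y(a, -z)b. *)
Lemma locality_Omg : exists K : 'X_{1..n},
  (forall i, ~~ (i <= K)%MM -> Y a (Omg i) b = 0) /\
  forall m, koszul R p q *: Y b (Omg m) a
    = sgn R (N + 1) *: \sum_(i <- below K | (m <= i)%MM)
        sgn R (mdeg i) *: T (i - m)%MM (Y a (Omg i) b).
Proof.
have [K loc] := locality_vac; exists K; split=> [i iK|m].
  (* At Omega_z^i the series d_w^(j) Delta is a multiple of w^(i - j),
     so that w^0 can occur only for j = i. *)
  rewrite -[b](cva_T0 hV) -comm_vac_Omg_Mon loc big_seq big1 // => j.
  rewrite mem_below => jK; rewrite kmul_Mon big_seq big1 // => l.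
  rewrite mem_below => l0; rewrite /= (_ : (i == _) = false) ?mul0rn ?scale0r //.
  apply/eqP => e; move: iK; rewrite e (_ : l = 0%MM) ?add0m ?jK //.
  by apply/mnmP => x; have := mnm_lepP l0 x; rewrite mnmE; case: (l x).
have := comm_vac_Mon_Omg 0%MM m; rewrite (cva_T0 hV) loc.
move=> /(congr1 -%R); rewrite opprK => <-.
have sgn1 : sgn R 1 = -1 by rewrite /sgn expr1.
rewrite addrC sgnD sgn1 -scalerA scaleN1r; congr (- _).
rewrite scaler_sumr [RHS]big_mkcond; apply: eq_bigr => j _.
have conc s' (x : V -> V) : s' <> Omg j ->
    hasse_w j (Delta R N (n := n)) (Mon 0%MM) s' *: x = 0.
  by move=> /hasse_Delta_Mon0 ->; rewrite scale0r.
case: ifP => mj; last first.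
  rewrite (kmul_concentrated0 _ conc) // => -[l|l] //=.
  by case: ifP => // lj [e]; rewrite -e lem_subr in mj.
rewrite (kmul_concentrated _ (t := Mon (j - m)%MM) conc) //=; last first.
  by rewrite lem_subr subm_subm.
rewrite lepm_refl subm_self eqxx mbinn !mulr1n scalrfctE res_comm_vac.
by rewrite scalerA mulrC.
Qed.

End Locality.

End VertexAlgebra.

Theorem proposition3p2p3 (R : comPzRingType) (N : int) (n : nat) (hn : (0 < n)%N)
    (V : lmodType R) (G : int -> set V)
    (Y : V -> series n {linear V -> V}) (T : 'X_{1..n} -> {linear V -> V})
    (vac : V) (hV : is_CVA N G Y T vac)
    (p q : int) (a b : V) (ha : G p a) (hb : G q b) :
  vapp Y a b
  = koszul R p q *:
      kmul (fun (f : V -> V) (v : V) => f v) (expT T) (negz N (vapp Y b a)).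
Proof.
(* The sign p(b,a) = p(a,b) squares to 1, so it may be put on the left. *)
have koszulK x : x = koszul R p q *: (koszul R q p *: x) :> V.
  by rewrite scalerA /koszul [q * p]mulrC sgn_sqr scale1r.
apply/funext => -[k|m]; rewrite [LHS]koszulK scalrfctE; congr (_ *: _).
  rewrite kmul_Mon /= -(locality_Mon hV hb ha); exact/esym/(expT_negz_Mon hV).
have [K [trunc sing]] := locality_Omg hV hb ha.
rewrite /vapp sing scaler_sumr (@kmul_Omg _ _ _ _ _ _ _ K) //=; last first.
  by move=> i iK; rewrite trunc // scaler0 linear0.
apply: eq_bigr => i mi.
by rewrite scalerA [sgn _ _ * _]mulrC -sgnD [RHS]linearZ /= addrA.
Qed.
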